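(* Let $\xi$ be a paratopology on a set $X$. The following are equivalent: (1) $\xi$ is countably deep; (2) $\xi$ is countably deep for ultrafilters; (3) $\xi$ is a pretopology; (4) every singleton is cover-$\mathbb{F}_{1*}/\mathbb{F}_{0*}$-compact, that is: for every $x\in X$ and every countably based filter $\mathcal{G}$ on $X$ with $x\notin\mathrm{adh}_\xi\,\mathcal{G}$, there is a principal filter $\mathcal{D}\subset\mathcal{G}$ with $x\notin\mathrm{adh}_\xi\,\mathcal{D}$.
   Context: Filters on $X$ are families of nonempty subsets of $X$ closed under finite intersections and supersets; $\bigwedge$ of a family of filters is their intersection. Two families of sets mesh, $\mathcal{A}\#\mathcal{B}$, if $A\cap B\neq\emptyset$ for all $A\in\mathcal{A},B\in\mathcal{B}$. A filter is principal if it is of the form $\{A\}^\uparrow=\{B\subset X: A\subset B\}$ with $A\neq\emptyset$, and countably based if it has a countable filter-base. A convergence $\xi$ on $X$ is a relation between points $x$ of $X$ and filters $\mathcal{F}$ on $X$, written $x\in\lim_\xi\mathcal{F}$, such that $x\in\lim_\xi\{x\}^{\uparrow}$ for all $x$, and $\mathcal{F}\subset\mathcal{G}$ implies $\lim_\xi\mathcal{F}\subset\lim_\xi\mathcal{G}$. The adherence of a filter $\mathcal{H}$ is $\mathrm{adh}_\xi\mathcal{H}=\bigcup_{\mathcal{F}\#\mathcal{H}}\lim_\xi\mathcal{F}$, the union over filters $\mathcal{F}$ on $X$ meshing with $\mathcal{H}$. $\xi$ is a paratopology (resp. a pretopology) if for every filter $\mathcal{F}$, $\lim_\xi\mathcal{F}=\bigcap\{\mathrm{adh}_\xi\mathcal{D}:\mathcal{D}\#\mathcal{F}\}$,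 where $\mathcal{D}$ ranges over all countably based (resp. principal) filters on $X$. $\xi$ is countably deep if $\lim_\xi\bigwedge_{\mathcal{F}\in\mathbb{A}}\mathcal{F}=\bigcap_{\mathcal{F}\in\mathbb{A}}\lim_\xi\mathcal{F}$ for every nonempty countable set $\mathbb{A}$ of filters on $X$; it is countably deep for ultrafilters if this holds for every nonempty countable set $\mathbb{A}$ of ultrafilters on $X$. *)

(* Defs.v *)
From mathcomp Require Import all_boot.
From mathcomp Require Import boolp classical_sets functions cardinality filter.

Set Implicit Arguments.
Unset Strict Implicit.
Unset Printing Implicit Defensive.

Local Open Scope classical_set_scope.

(* A filter on X is a set_system X satisfying ProperFilter (a Filter that does
   not contain set0).  Since cvlim xi F is a set of points for every set system
   F, cvlim_filter makes xi a relation between points and proper filters only.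

   The names avoid the library's lim and convergence vocabulary for
   topological spaces. *)
Record convergence (X : Type) := Convergence {
  cvlim : set_system X -> set X;
  cvlim_filter : forall (F : set_system X) (x : X), cvlim F x -> ProperFilter F;
  cvlim_point : forall x : X, cvlim (principal_filter x) x;
  cvlim_mono : forall F G : set_system X, ProperFilter F -> ProperFilter G ->
    F `<=` G -> cvlim F `<=` cvlim G }.

Definition adh (X : Type) (xi : convergence X) (H : set_system X) : set X :=
  \bigcup_(F in [set F | ProperFilter F /\ F `#` H]) cvlim xi F.

(* globally A is the family of all supersets of A. *)
Definition principal (X : Type) (F : set_system X) : Prop :=
  exists2 A : set X, A !=set0 & F = globally A.

(* filter_from B id is the family of all supersets of members of B; in
   particular the equation forces B to be included in F. *)
Definition countably_based (X : Type) (F : set_system X) : Prop :=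
  exists2 B : set_system X, countable B & F = filter_from B id.

Definition paratopology (X : Type) (xi : convergence X) : Prop :=
  forall F : set_system X, ProperFilter F ->
    cvlim xi F = \bigcap_(D in [set D | [/\ ProperFilter D, countably_based D
                                          & D `#` F]]) adh xi D.

Definition pretopology (X : Type) (xi : convergence X) : Prop :=
  forall F : set_system X, ProperFilter F ->
    cvlim xi F = \bigcap_(D in [set D | [/\ ProperFilter D, principal D
                                          & D `#` F]]) adh xi D.

(* \bigcap_(F in A) F is the infimum of the filters in A; countable sets may
   be finite. *)
Definition countably_deep (X : Type) (xi : convergence X) : Prop :=
  forall A : set (set_system X), A !=set0 -> countable A ->
    (forall F, A F -> ProperFilter F) ->
    cvlim xi (\bigcap_(F in A) F) = \bigcap_(F in A) cvlim xi F.

Definition countably_deep_for_ultrafilters (X : Type) (xi : convergence X) :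
    Prop :=
  forall A : set (set_system X), A !=set0 -> countable A ->
    (forall F, A F -> UltraFilter F) ->
    cvlim xi (\bigcap_(F in A) F) = \bigcap_(F in A) cvlim xi F.

Definition singletons_cover_compact (X : Type) (xi : convergence X) : Prop :=
  forall (x : X) (G : set_system X), ProperFilter G -> countably_based G ->
    ~ adh xi G x ->
    exists D : set_system X,
      [/\ ProperFilter D, principal D, D `<=` G & ~ adh xi D x].

(* Main.v *)
(** A point [x] adheres to a set [A] iff some filter converging to [x] does not
    contain the complement of [A].
    - (2) => (3): let [x] adhere to every set meshing with [F], and let [D] be
      countably based, with [D # F].  Choose an ultrafilter converging to [x]
      through each member of a countable base of [D]; the infimum of these
      ultrafilters converges to [x] and meshes with [D].
    - (3) => (4): in a pretopology the infimum of all filters converging to [x]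
      converges to [x], and it meshes with [G] as soon as [x] adheres to every
      member of [G].
    - (4) => (1): by (4), if [x] fails to adhere to a countably based [D] then
      it fails to adhere to some member [A] of [D].  The complement of [A] then
      lies in every filter converging to [x], so [D] does not mesh with the
      infimum of any family of such filters. *)

Require Import Defs.
From mathcomp Require Import all_boot.
From mathcomp Require Import boolp classical_sets functions cardinality filter.

Set Implicit Arguments.
Unset Strict Implicit.
Unset Printing Implicit Defensive.

Local Open Scope classical_set_scope.

Lemma bigcap_proper_filter (X : Type) (A : set (set_system X)) :
  A !=set0 -> (forall F, A F -> ProperFilter F) ->
  ProperFilter (\bigcap_(F in A) F).
Proof.
move=> [F0 AF0] AP; split; first by move=> /(_ _ AF0); have [] := AP _ AF0.
split.
- by move=> F /AP FP; apply: filterT.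
- by move=> P Q AP' AQ F AF; have FP := AP _ AF; apply: filterI;
    [apply: AP'|apply: AQ].
- by move=> P Q PQ AP' F AF; have FP := AP _ AF; apply: filterS PQ _; apply: AP'.
Qed.

Lemma meets_globally_setC (X : Type) (F : set_system X) (A : set X) :
  Filter F -> F `#` globally A <-> ~ F (~` A).
Proof.
move=> FF; rewrite meets_globallyr; split=> [FA /FA [x []] //|nFA B FB].
apply: contrapT => AB0; apply: nFA; apply: filterS FB => x Bx Ax.
by apply: AB0; exists x.
Qed.

(** Any ultrafilter finer than the trace [within A F] works. The trace is proper: it contains the
    empty set only if [F] contains the complement of [A], which meshing excludes. *)
Lemma ultrafilter_through (X : Type) (F : set_system X) (A : set X) :
  ProperFilter F -> F `#` globally A ->
  exists G, [/\ UltraFilter G, F `<=` G & G A].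
Proof.
move=> FP FA.
have /ultraFilterLemma [G [GU FG]] : ProperFilter (within A F).
  split; last exact: within_filter.
  by move: FA => /meets_globally_setC.
exists G; split=> //; last by apply: FG; apply: withinT.
move=> B FB; apply: FG; rewrite /within /=.
by apply: filterS FB => x Bx _.
Qed.

Section Convergence.
Variables (X : Type) (xi : convergence X).

Lemma adh_globallyP (A : set X) (x : X) :
  adh xi (globally A) x <-> exists2 F, cvlim xi F x & ~ F (~` A).
Proof.
split=> [[F [FP /meets_globally_setC FA] Fx]|[F Fx nFA]]; first by exists F.
have FP := cvlim_filter Fx.
by exists F => //; split=> //; apply/meets_globally_setC.
Qed.

Lemma ultra_adh_globally (A : set X) (x : X) : adh xi (globally A) x ->
  exists U, [/\ UltraFilter U, U A & cvlim xi U x].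
Proof.
move=> [F [FP FA] Fx]; have [U [UU FU UA]] := ultrafilter_through FP FA.
by exists U; split=> //; apply: cvlim_mono FU _ Fx.
Qed.

Lemma cvlim_adh (F D : set_system X) : ProperFilter F -> D `#` F ->
  cvlim xi F `<=` adh xi D.
Proof. by move=> FP DF x Fx; exists F => //; split=> //; rewrite meetsC. Qed.

Lemma cvlim_bigcap_sub (A : set (set_system X)) :
  A !=set0 -> (forall F, A F -> ProperFilter F) ->
  cvlim xi (\bigcap_(F in A) F) `<=` \bigcap_(F in A) cvlim xi F.
Proof.
move=> A0 AP x Ax F AF; have IP := bigcap_proper_filter A0 AP.
by apply: cvlim_mono Ax => //; [exact: AP|move=> B; exact].
Qed.

Lemma countably_deep_ultra :
  countably_deep xi -> countably_deep_for_ultrafilters xi.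
Proof.
by move=> deep A A0 cA AU; apply: deep => // F /AU FU; apply: ultra_proper.
Qed.

Lemma countably_deep_ultra_adh (D : set_system X) (x : X) :
  countably_deep_for_ultrafilters xi -> ProperFilter D -> countably_based D ->
  (forall A, D A -> adh xi (globally A) x) -> adh xi D x.
Proof.
move=> deep DP [B cB DE] Dx.
have BD A : B A -> D A by move=> BA; rewrite DE; exists A.
have [A0 BA0] : B !=set0.
  by have : D setT; [apply: filterT|rewrite DE => -[A BA _]; exists A].
have /choice [U UP] A : exists U : set_system X,
    B A -> [/\ UltraFilter U, U A & cvlim xi U x].
  have [/BD/Dx/ultra_adh_globally [U UP]|nBA] := pselect (B A); first by exists U.
  (* Nothing is required off [B], so any set system serves as a default. *)
  by exists setT.
have UBU F : (U @` B) F -> UltraFilter F by move=> [A /UP[UU _ _] <-].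
have UB0 : U @` B !=set0 by exists (U A0); exists A0.
have cUB : countable (U @` B).
  by apply: sub_countable cB; apply: card_image_le.
exists (\bigcap_(F in U @` B) F); last first.
  by rewrite deep // => _ [A /UP[_ _ Ux] <-].
split; first by apply: bigcap_proper_filter => // F /UBU FU; apply: ultra_proper.
(* [Q] contains a base member [A], so [P] and [Q] both belong to the proper filter [U A]. *)
move=> P Q UBP; rewrite DE => -[A BA AQ].
have [UU UA _] := UP _ BA.
have UPA : U A P by apply: UBP; exists A.
exact: filter_ex (filterI UPA (filterS AQ UA)).
Qed.

Lemma countably_deep_ultra_pretopology : paratopology xi ->
  countably_deep_for_ultrafilters xi -> pretopology xi.
Proof.
move=> para deep F FP; apply/seteqP; split=> x.
  by move=> Fx D [_ _ DF]; apply: cvlim_adh Fx.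
move=> pFx; rewrite para // => D [DP cD DF].
apply: countably_deep_ultra_adh => // A DA.
(* [globally A] is coarser than [D], hence meshes with [F] as [D] does. *)
have [a Aa] := filter_ex DA.
apply: pFx; split; [exact: globally_properfilter Aa|by exists A => //; exists a|].
by rewrite meets_globallyl => P; apply: DF.
Qed.

(** The infimum is the vicinity filter of [x]. If it meshes with [A], some filter converging to [x]
    omits the complement of [A], so [x] adheres to [A]; this is the pretopological criterion for
    convergence to [x]. *)
Lemma pretopology_cvlim_vicinity (x : X) : pretopology xi ->
  cvlim xi (\bigcap_(F in [set F | cvlim xi F x]) F) x.
Proof.
move=> pre; set V := \bigcap_(_ in _) _.
have VP : ProperFilter V.
  apply: bigcap_proper_filter; last by move=> F; apply: cvlim_filter.
  by exists (principal_filter x); apply: cvlim_point.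
rewrite pre // => _ [_ [A _ ->]]; rewrite meetsC => /meets_globally_setC VA.
apply/adh_globallyP; apply: contrapT => nA; apply: VA => F Fx.
by apply: contrapT => nFA; apply: nA; exists F.
Qed.

Lemma pretopology_adh (G : set_system X) (x : X) : pretopology xi ->
  (forall A, G A -> adh xi (globally A) x) -> adh xi G x.
Proof.
move=> pre Gx; have Vx := pretopology_cvlim_vicinity x pre.
apply: (cvlim_adh (cvlim_filter Vx) _ Vx) => A P GA VP.
have [F [_ FA] Fx] := Gx _ GA.
by move: FA; rewrite meetsC meets_globallyl; apply; apply: VP.
Qed.

Lemma pretopology_cover_compact :
  pretopology xi -> singletons_cover_compact xi.
Proof.
move=> pre x G GP _; apply: contra_notP => nD.
apply: pretopology_adh => // A GA; apply: contrapT => nAx.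
have [a Aa] := filter_ex GA.
apply: nD; exists (globally A); split=> //.
- exact: globally_properfilter Aa.
- by exists A => //; exists a.
- by move=> P AP; apply: filterS GA.
Qed.

Lemma cover_compact_countably_deep : paratopology xi ->
  singletons_cover_compact xi -> countably_deep xi.
Proof.
move=> para cc A A0 _ AP; have IP := bigcap_proper_filter A0 AP.
apply/seteqP; split; first exact: cvlim_bigcap_sub.
move=> x Ax; rewrite para // => D [DP cD DI].
apply: contrapT => nDx.
have [_ [_ [B _ ->] BD]] := cc _ _ DP cD nDx; apply.
apply/adh_globallyP; apply: contrapT => nB.
have VB : (\bigcap_(F in A) F) (~` B).
  by move=> F AF; apply: contrapT => nFB; apply: nB; exists F => //; apply: Ax.
(* Meshing would make [B] meet its own complement. *)
by have [|y []] := DI B (~` B) _ VB; first exact: BD.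
Qed.

End Convergence.

Theorem corollary23 (X : Type) (xi : convergence X) (hxi : paratopology xi) :
  [<-> countably_deep xi;
       countably_deep_for_ultrafilters xi;
       pretopology xi;
       singletons_cover_compact xi].
Proof.
tfae.
- exact: countably_deep_ultra.
- exact: countably_deep_ultra_pretopology.
- exact: pretopology_cover_compact.
- exact: cover_compact_countably_deep.
Qed.
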